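(* Let $n\ge1$, let $\lambda=(\lambda_1,\dots,\lambda_n)$ be a partition of length at most $n$, and let $$\phi(t)=\left(t^{\lambda_1-\lambda_2+1},t^{\lambda_1-\lambda_3+2},\dots,t^{\lambda_1-\lambda_n+(n-1)},t^{\lambda_1+n}\right)^T,\qquad t\in\,]0,\infty[ .$$ Let $(\lambda^{(0)},\lambda^{(1)},\dots,\lambda^{(n)})$ be the Müntz tableau associated with $\lambda$. Then for any $(u_1,\dots,u_n)\in\,]0,+\infty[^n$, the Chebyshev blossom $\varphi=(\varphi_1,\dots,\varphi_n)^T$ of $\phi$ is given by $$\varphi_i(u_1,\dots,u_n)=\frac{f_{\lambda^{(0)}}(n)\,S_{\lambda^{(i)}}(u_1,\dots,u_n)}{f_{\lambda^{(i)}}(n)\,S_{\lambda^{(0)}}(u_1,\dots,u_n)},\qquad i=1,\dots,n.$$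
   Context: Partitions and Schur functions: a partition of length at most $n$ is a sequence of integers $\lambda_1\ge\dots\ge\lambda_n\ge0$; partitions differing only by trailing zeros are identified. For a partition $\mu$ of length at most $m$, $S_\mu(u_1,\dots,u_m)=\det(u_i^{\mu_j+m-j})_{1\le i,j\le m}/\det(u_i^{m-j})_{1\le i,j\le m}$ is the Schur polynomial (evaluated also at coinciding arguments, being a polynomial). $f_\mu(m)=S_\mu(1,\dots,1)$ ($m$ ones) is the number of semi-standard Young tableaux of shape $\mu$ with entries at most $m$. Müntz tableau of $\lambda=(\lambda_1,\dots,\lambda_n)$: $\lambda^{(0)}=(\lambda_2,\dots,\lambda_n)$; $\lambda^{(i)}=(\lambda_1+1,\dots,\lambda_i+1,\lambda_{i+2},\dots,\lambda_n)$ for $1\le i\le n-1$; $\lambda^{(n)}=(\lambda_1+1,\dots,\lambda_n+1)$. Chebyshev blossom: the map $\phi$ is a Chebyshev function of order $n$ on $I=\,]0,\infty[$, i.e. each non-zero element of $\mathrm{span}(\phi_1',\dots,\phi_n')$ (which is $n$-dimensional) has at most $n-1$ zeros on $I$ counting multiplicities. Let $\mathrm{Osc}_i\phi(t)=\{\phi(t)+\alpha_1\phi'(t)+\dots+\alpha_i\phi^{(i)}(t):\alpha_j\in\mathbb{R}\}$. For a tuple $(u_1,\dots,u_n)\in I^n$ consisting, up to order, of distinct points $\tau_1,\dots,\tau_r$ with multiplicities $\mu_1,\dots,\mu_r$ ($\sum\mu_k=n$), the blossom value $\varphi(u_1,\dots,u_n)\in\mathbb{R}^n$ is the unique point of $\bigcap_{k=1}^r\mathrm{Osc}_{n-\mu_k}\phi(\tau_k)$.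 *)

(* Defs.v *)
From HB Require Import structures.
From mathcomp Require Import all_boot all_order all_algebra.
From mathcomp Require Import all_classical all_reals all_analysis.
(* mpoly's notations clash with those of MathComp-Analysis, hence [mpoly m R]
   for the polynomials in m variables over R and [meval u p] for p(u). *)
From mathcomp Require Export -(notations) mpoly.
Export numFieldNormedType.Exports.

Set Implicit Arguments.
Unset Strict Implicit.
Unset Printing Implicit Defensive.

Import Order.TTheory GRing.Theory Num.Theory.

Local Open Scope classical_set_scope.
Local Open Scope ring_scope.

(* A partition is a non-increasing sequence of naturals; its parts are read
   with [nth 0%N], so that trailing zeros are immaterial.  All indices start
   at 0: the j-th part (j >= 1) of mu is [nth 0%N mu j.-1]. *)

(* The determinant of the matrix (X_i ^ (mu_j + m - j)), 1 <= i, j <= m. *)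
Definition alternant (R : idomainType) (m : nat) (mu : seq nat) : mpoly m R :=
  \det (\matrix_(i < m, j < m)
    (mpolyX R (mnm1 i) ^+ (nth 0%N mu j + (m - j.+1))%N)).

(* The Schur polynomial of mu in m variables, for mu of length at most m: the
   quotient of the alternant of mu by that of the empty partition (the
   Vandermonde determinant).  The quotient exists, and it is unique because
   the Vandermonde determinant is non-zero and polynomials over an integral
   domain form one; the default value 0 of [xget] is thus never reached. *)
Definition schur (R : idomainType) (m : nat) (mu : seq nat) : mpoly m R :=
  xget 0 [set s | s * alternant R m [::] = alternant R m mu].

Definition schur_at (R : idomainType) (m : nat) (mu : seq nat)
  (u : 'I_m -> R) : R := meval u (schur R m mu).

Definition schur_ones (R : idomainType) (m : nat) (mu : seq nat) : R :=
  schur_at mu (fun _ : 'I_m => 1).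

(* The i-th row of the Muntz tableau of lambda, 0 <= i <= n:
   (lambda_1 + 1, ..., lambda_i + 1, lambda_(i+2), ..., lambda_n). *)
Definition muntz_row (lam : seq nat) (i : nat) : seq nat :=
  [seq l.+1 | l <- take i lam] ++ drop i.+1 lam.

(* The (i+1)-st coordinate has exponent lambda_1 - lambda_(i+2) + (i+1), where
   lambda_(n+1) = 0, so that the last exponent is lambda_1 + n.  The
   subtraction of naturals is exact since lambda is non-increasing. *)
Definition muntz_curve (R : realType) (n : nat) (lam : seq nat) (t : R) :
  'cV[R]_n :=
  \col_(i < n) t ^+ (nth 0%N lam 0 - nth 0%N lam i.+1 + i.+1)%N.

Definition osculating (R : realType) (n : nat) (phi : R -> 'cV[R]_n)
  (i : nat) (t : R) : set 'cV[R]_n :=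
  [set x | exists alpha : 'I_i -> R,
     x = phi t + \sum_(j < i) alpha j *: derive1n j.+1 phi t].

Definition multiplicity (R : realType) (n : nat) (u : 'I_n -> R) (t : R) :
  nat := #|[pred k | u k == t]|.

Definition osculating_meet (R : realType) (n : nat) (phi : R -> 'cV[R]_n)
  (u : 'I_n -> R) : set 'cV[R]_n :=
  \bigcap_(t in range u) osculating phi (n - multiplicity u t) t.

(* The unique point of the intersection of the osculating flats; it is 0 by
   convention when this intersection is not a single point.  In particular, an
   identity between a blossom and a non-zero vector entails that the
   intersection is exactly this vector. *)
Definition blossom (R : realType) (n : nat) (phi : R -> 'cV[R]_n)
  (u : 'I_n -> R) : 'cV[R]_n :=
  xget 0 [set p | osculating_meet phi u = [set p]].

(* Main.v *)
Require Import Defs.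
From HB Require Import structures.
From mathcomp Require Import all_boot all_order all_algebra.
From mathcomp Require Import perm ring zify.
From mathcomp Require Import all_classical all_reals all_analysis.

Import Order.TTheory GRing.Theory Num.Theory.

Local Open Scope ring_scope.

(** Put D_i = lam_(i+1) + n - i for 0 <= i <= n, with lam_(n+1) = 0.  The
    exponents of the alternant of the i-th row of the Muntz tableau are the D_j
    with j <> i, and those of the curve are e_i = D_0 - D_i for i > 0; with
    e_0 = 0 this describes the curve (1, phi) in homogeneous coordinates.

    A Schur polynomial is a determinant of Newton coefficients
    h_(a-k)(u_0, ..., u_k) (lemma [schurE]), so it can be evaluated at
    coinciding arguments without any limit.  Consequently the signed values
    q_i = (-1)^i S_(lam^(i))(u) are, up to a common sign, the maximal minors of
    the n x (n+1) matrix of the Newton coefficients of the X^(D_i), which says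
    that prod_k (X - u_k) divides Q = sum_i q_i X^(D_i).  For u = (1, ..., 1)
    this gives weights w_i = (-1)^i f_(lam^(i))(n) such that (X - 1)^n divides
    sum_i w_i X^(D_i).

    For t <> 0, a sum sum_i v_i X^(D_i) is divisible by (X - t)^m if and only if
    the weights v_i t^(D_i) on the nodes D_i annihilate the polynomials of degree
    < m (lemma [XsubC_exp_dvdP]).  So the w_i annihilate all degrees < n: they
    are proportional to the coefficients 1 / prod_(j <> i) (D_i - D_j) of the
    divided difference on the D_i.  If t is a point of multiplicity m in u and
    g interpolates q_i t^(D_i) / w_i at D_i, then w_i g(D_i) annihilates the
    degrees < m, and as the divided difference reads off leading coefficients,
    deg g <= n - m; the converse is immediate.  But the flat Osc_d phi(t)
    consists of the points (t^(e_i) g(e_i))_i with deg g <= d and g(0) = 1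
    (lemma [osculatingP]), and e_i = D_0 - D_i.  Hence the point with
    homogeneous coordinates q_i / w_i lies in every osculating flat, and any
    point x of the intersection yields a polynomial sum_i w_i x_i X^(D_i)
    divisible by prod_k (X - u_k).

    Both the uniqueness of that polynomial up to a scalar and the non-vanishing
    of the Schur values come from Descartes' rule of signs: a non-zero
    combination of m monomials has fewer than m positive roots, counted with
    multiplicity (lemma [sparse_eq0]). *)

Set Implicit Arguments.
Unset Strict Implicit.
Unset Printing Implicit Defensive.

(** * Newton expansions of monomials *)

Section Newton.
Variables (A : comNzRingType) (x : nat -> A).

(** The coefficient of t^a on prod_(l < k) (t - x_l), that is, the complete
    homogeneous symmetric polynomial h_(a-k)(x_0, ..., x_k), which is also the
    divided difference of t^a at x_0, ..., x_k. *)
Fixpoint newton_coef (a k : nat) : A :=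
  if a is a'.+1 then
    (if k is k'.+1 then newton_coef a' k' else 0) + x k * newton_coef a' k
  else (k == 0)%:R.

Definition newton_basis (k : nat) (t : A) : A := \prod_(l < k) (t - x l).

Lemma newton_basisS k t :
  newton_basis k.+1 t = newton_basis k t * (t - x k).
Proof. by rewrite /newton_basis big_ord_recr. Qed.

Lemma newton_basis_eq0 k l : (l < k)%N -> newton_basis k (x l) = 0.
Proof.
by move=> lk; rewrite /newton_basis (bigD1 (Ordinal lk)) //= subrr mul0r.
Qed.

Lemma newton_coef_gt a k : (a < k)%N -> newton_coef a k = 0.
Proof.
elim: a k => [|a IHa] [|k] //= ak.
by rewrite !IHa ?mulr0 ?addr0 //; apply: ltnW.
Qed.

Lemma newton_coef_diag a : newton_coef a a = 1.
Proof. by elim: a => //= a ->; rewrite newton_coef_gt // mulr0 addr0. Qed.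

(** The remainder term makes this valid for every truncation K: it vanishes at
    the points x_l with l < K, and it is a multiple of [newton_basis K], which
    is what divisibility statements need. *)
Lemma newton_expansion K a t : exists s, t ^+ a =
  \sum_(k < K) newton_coef a k * newton_basis k t + s * newton_basis K t.
Proof.
elim: a => [|a [s IHa]].
  case: K => [|K].
    by exists 1; rewrite big_ord0 mul1r /newton_basis big_ord0 add0r.
  exists 0; rewrite big_ord_recl /= big1 => [|k _]; last by rewrite mul0r.
  by rewrite /newton_basis big_ord0 mulr1 addr0 mul0r addr0.
pose sh k := if k is k'.+1 then newton_coef a k' else 0.
exists (t * s + sh K).
have shE : \sum_(k < K) newton_coef a k * newton_basis k.+1 t =
    \sum_(k < K) sh k * newton_basis k t + sh K * newton_basis K t.
  have -> : \sum_(k < K) newton_coef a k * newton_basis k.+1 t =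
      \sum_(k < K.+1) sh k * newton_basis k t.
    by rewrite big_ord_recl /= mul0r add0r.
  by rewrite big_ord_recr.
have -> : \sum_(k < K) newton_coef a.+1 k * newton_basis k t =
    \sum_(k < K) sh k * newton_basis k t +
    \sum_(k < K) x k * (newton_coef a k * newton_basis k t).
  by rewrite -big_split; apply: eq_bigr => k _ /=; rewrite mulrDl mulrA.
rewrite exprS {}IHa mulrDr mulr_sumr.
have -> : \sum_(k < K) t * (newton_coef a k * newton_basis k t) =
    \sum_(k < K) newton_coef a k * newton_basis k.+1 t +
    \sum_(k < K) x k * (newton_coef a k * newton_basis k t).
  rewrite -big_split; apply: eq_bigr => k _ /=; rewrite newton_basisS; ring.
rewrite shE; ring.
Qed.

Definition newton_mx m n (a : 'I_n -> nat) : 'M[A]_(m, n) :=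
  \matrix_(k < m, j < n) newton_coef (a j) k.

(** The first factor does not depend on the exponents: it is the common factor
    of all alternants. *)
Lemma power_mx_factor m n (a : 'I_n -> nat) :
  \matrix_(i < m, j < n) x i ^+ a j =
  (\matrix_(i < m, k < m) newton_basis k (x i)) *m newton_mx m a.
Proof.
apply/matrixP => i j; rewrite !mxE.
have [s ->] := newton_expansion m (a j) (x i).
rewrite newton_basis_eq0 // mulr0 addr0.
by apply: eq_bigr => k _; rewrite !mxE mulrC.
Qed.

Definition rev_sign m : A := (-1) ^+ odd_perm (perm (@rev_ord_inj m)).

(** The exponents m-1, ..., 0 are those of the empty partition.  Once they are
    put in increasing order the matrix is unitriangular. *)
Lemma det_newton_mx_rev m : \det (newton_mx m (@rev_ord m)) = rev_sign m.
Proof.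
have -> : newton_mx m (@rev_ord m) =
    col_perm (perm (@rev_ord_inj m)) (newton_mx m (@nat_of_ord m)).
  by apply/matrixP => i j; rewrite !mxE permE.
rewrite col_permE det_mulmx det_perm -det_tr det_trig; last first.
  by apply/is_trig_mxP => i j ij; rewrite !mxE newton_coef_gt.
rewrite big1 => [|k _]; last by rewrite !mxE newton_coef_diag.
by rewrite mul1r odd_permV.
Qed.
End Newton.

Lemma newton_coef_morph (A B : comNzRingType) (f : {rmorphism A -> B}) x a k :
  f (newton_coef x a k) = newton_coef (f \o x) a k.
Proof.
elim: a k => [|a IHa] [|k] /=; rewrite ?rmorph_nat //.
  by rewrite rmorphD rmorphM IHa rmorph0.
by rewrite rmorphD rmorphM !IHa.
Qed.

Lemma eq_newton_coef (A : comNzRingType) (x y : nat -> A) m a k :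
  (k < m)%N -> (forall l, (l < m)%N -> x l = y l) ->
  newton_coef x a k = newton_coef y a k.
Proof.
move=> km xy; elim: a k km => [|a IHa] [|k] km //=; rewrite xy // !IHa //.
exact: ltnW.
Qed.

Lemma newton_coef_const (A : comNzRingType) (t : A) a k :
  newton_coef (fun=> t) a k = t ^+ (a - k) *+ 'C(a, k).
Proof.
elim: a k => [|a IHa] [|k] /=; rewrite ?sub0n ?mulr1n //.
  by rewrite IHa !bin0 !subn0 !mulr1n add0r -exprS.
rewrite !IHa binS addnC mulrnDr subSS; congr (_ + _).
have [lt|ge] := ltnP k a; first by rewrite mulrnAr -exprS subnSK.
by rewrite bin_small // !mulr0n mulr0.
Qed.

(** * Descartes' rule of signs *)

Section SignChanges.
Variable R : realDomainType.
Implicit Types (f g : nat -> R) (s : R) (k m : nat).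

(** A chain of k+1 increasing indices, all at least m, along which f takes
    values of alternating strict signs, the first being the sign of s.  Chains
    are easier to lengthen than an exact count of sign changes. *)
Fixpoint alternates f s m k : Prop :=
  exists i, [/\ (m <= i)%N, 0 < s * f i &
    if k is k'.+1 then alternates f (- s) i.+1 k' else True].

Lemma alternates_le f s m m' k : (m' <= m)%N ->
  alternates f s m k -> alternates f s m' k.
Proof.
by case: k => [|k] mm' [i [mi fi Hi]]; exists i; rewrite (leq_trans mm').
Qed.

Lemma sum_pos_term (f : nat -> R) m n : 0 < \sum_(m <= j < n) f j ->
  exists j, [/\ (m <= j)%N, (j < n)%N & 0 < f j].
Proof.
move=> fpos.
have [/hasP[j]|/hasPn fle] := boolP (has (fun j => 0 < f j) (index_iota m n)).
  by rewrite mem_index_iota => /andP[mj jn] fj; exists j.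
have : \sum_(m <= j < n) f j <= 0.
  rewrite big_seq sumr_le0 // => j jmn; rewrite leNgt; exact: fle.
by rewrite leNgt fpos.
Qed.

Definition pred_val f i := if i is j.+1 then f j else 0.

(** Between two consecutive terms of a chain of f, some difference has the sign
    of the total variation.  Since f enters the chain from a value of the other
    sign or 0, and finally returns to 0, one more sign is obtained than in the
    chain of f. *)
Lemma alternates_diff f s m k :
  (exists M, forall i, (M <= i)%N -> f i = 0) ->
  s * pred_val f m <= 0 -> alternates f s m k ->
  alternates (fun i => pred_val f i - f i) (- s) m k.+1.
Proof.
move=> [M fM]; pose g i := pred_val f i - f i.
have sumg a b : (a <= b)%N ->
    \sum_(a <= j < b) g j = pred_val f a - pred_val f b.
  move=> ab; rewrite -[RHS]opprB -telescope_sumr // -sumrN.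
  by apply: eq_bigr => j _; rewrite opprB.
have step s' a b : (a <= b)%N -> s' * pred_val f a <= 0 -> 0 < s' * f b ->
    exists j, [/\ (a <= j <= b)%N & 0 < - s' * g j].
  move=> ab fa fb.
  have /sum_pos_term [j [aj jb gj]] : 0 < \sum_(a <= j < b.+1) - s' * g j.
    rewrite -mulr_sumr sumg /=; last exact: leqW.
    by rewrite mulNr mulrBr opprB subr_gt0 (le_lt_trans fa).
  by exists j; rewrite aj.
elim: k s m => [|k IHk] s m fm [i [mi fi Hi]].
  have [j [/andP[mj ji] gj]] := step _ _ _ mi fm fi.
  exists j; split=> //; rewrite opprK.
  have /sum_pos_term [l [jl _ gl]] : 0 < \sum_(i.+1 <= l < (maxn M i).+1) s * g l.
    rewrite -mulr_sumr sumg /= ?ltnS ?leq_maxr //.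
    by rewrite (fM (maxn M i)) ?leq_maxl // subr0.
  by exists l; split=> //; exact: leq_trans jl.
have [j [/andP[mj ji] gj]] := step _ _ _ mi fm fi.
exists j; split=> //.
apply: (@alternates_le _ _ i.+1) => //.
apply: IHk => //=.
by rewrite mulNr oppr_le0 ltW.
Qed.

Lemma alternates_size f s m k (r : seq nat) :
  (forall i, f i != 0 -> i \in r) -> alternates f s m k ->
  (k < count (leq m) (undup r))%N.
Proof.
move=> fr; elim: k s m => [|k IHk] s m [i [mi fi Hi]].
all: have ir : i \in undup r by rewrite mem_undup; apply: fr;
  apply: contraTneq fi => ->; rewrite mulr0 ltxx.
  by rewrite -has_count; apply/hasP; exists i.
have {IHk}Hi := IHk _ _ Hi.
rewrite (leq_ltn_trans Hi) //.
rewrite -!size_filter.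
have -> : [seq x <- undup r | (i < x)%N] =
   [seq x <- rem i (undup r) | (i < x)%N].
  by rewrite rem_filter ?undup_uniq // -filter_predI; apply: eq_filter => x /=;
   case: ltngtP => //=.
rewrite !size_filter.
have /seq.permP -> : perm_eq (undup r) (i :: rem i (undup r)) by rewrite perm_to_rem.
rewrite /= mi add1n ltnS; apply: sub_count => x /= ix.
by rewrite (leq_trans mi) // ltnW.
Qed.

Lemma eq_alternates f g s m k : (forall i, 0 < s * f i -> 0 < s * g i) ->
 (forall i, 0 < - s * f i -> 0 < - s * g i) ->
  alternates f s m k -> alternates g s m k.
Proof.
elim: k s m => [|k IHk] s m fg fg' [i [mi fi Hi]]; exists i; split; auto.
by apply: IHk Hi => //; rewrite opprK.
Qed.
End SignChanges.

Section Descartes.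
Variable R : realFieldType.

(** Descartes' induction step: each positive root adds a sign change.  After the
    rescaling p_i to a^i p_i, multiplication by X - a becomes, up to positive
    factors, the difference operator of [alternates_diff]. *)
Lemma alternates_mulXsubC (p : {poly R}) (a s : R) k : 0 < a ->
  alternates (fun i => p`_i) s 0 k ->
  alternates (fun i => (p * ('X - a%:P))`_i) (- s) 0 k.+1.
Proof.
move=> a0 altp.
have an i : 0 < a ^+ i by rewrite exprn_gt0.
have coefE i : (pred_val (fun i => a ^+ i * p`_i) i - a ^+ i * p`_i) * a =
    a ^+ i * (p * ('X - a%:P))`_i.
  rewrite mulrBr coefB coefMX coefMC; case: i => [|i] /=; rewrite ?exprS.
    by ring.
  by ring.
have pos s' i :
    (0 < s' * (pred_val (fun i => a ^+ i * p`_i) i - a ^+ i * p`_i)) =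
    (0 < s' * (p * ('X - a%:P))`_i).
  by rewrite -(pmulr_lgt0 _ a0) -mulrA coefE mulrCA pmulr_rgt0.
apply: (@eq_alternates _ (fun i => pred_val (fun i => a ^+ i * p`_i) i - a ^+ i * p`_i)).
- by move=> i; rewrite pos.
- by move=> i; rewrite pos.
apply: alternates_diff.
- by exists (size p) => i ip; rewrite nth_default // mulr0.
- by rewrite mulr0.
by apply: eq_alternates altp => i /=; rewrite mulrCA (pmulr_rgt0 _ (an i)).
Qed.

Lemma alternates_prod_XsubC (us : seq R) (p : {poly R}) :
  all (fun y => 0 < y) us -> p != 0 ->
  exists s, alternates (fun i => (p * \prod_(y <- us) ('X - y%:P))`_i) s 0 (size us).
Proof.
move=> us0 p0; elim: us us0 => [_|a us IHus /= /andP[a0 /IHus[s alt]]].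
  exists (lead_coef p); exists (size p).-1; split=> //.
  by rewrite big_nil mulr1 -/(lead_coef p) -expr2 exprn_even_gt0 //= lead_coef_eq0.
exists (- s).
by rewrite big_cons mulrCA mulrC; exact: alternates_mulXsubC.
Qed.

Definition sparse m (a : 'I_m -> nat) (v : 'I_m -> R) : {poly R} :=
  \sum_(j < m) v j *: 'X^(a j).

Lemma coef_sparse m (a : 'I_m -> nat) v i : injective a ->
  (sparse a v)`_(a i) = v i.
Proof.
move=> ainj; rewrite coef_sum (bigD1 i) //= coefZ coefXn eqxx mulr1.
rewrite big1 ?addr0 // => j ji; rewrite coefZ coefXn (inj_eq ainj) eq_sym.
by rewrite (negPf ji) mulr0.
Qed.

(** The number of non-zero coefficients exceeds the number of sign changes, so
    m monomials cannot have m positive roots. *)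
Lemma sparse_eq0 m (a : 'I_m -> nat) v (us : seq R) : injective a ->
  all (fun y => 0 < y) us -> (m <= size us)%N ->
  \prod_(y <- us) ('X - y%:P) %| sparse a v -> forall i, v i = 0.
Proof.
move=> ainj us0 mus /dvdpP[p pE] i.
rewrite -(coef_sparse v i ainj).
have [p0|p0] := eqVneq p 0; first by rewrite pE p0 mul0r coef0.
have [s] := alternates_prod_XsubC us0 p0; rewrite -pE.
have supp j : (sparse a v)`_j != 0 -> j \in codom a.
  apply: contraR => ja; rewrite coef_sum big1 // => l _.
  rewrite coefZ coefXn; case: eqP => [jE|_]; last by rewrite mulr0.
  by rewrite jE codom_f in ja.
move=> /(alternates_size supp).
rewrite ltnNge (leq_trans (count_size _ _)) //.
by rewrite (leq_trans (size_undup _)) // size_codom card_ord.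
Qed.
End Descartes.

(** * Divisibility of sparse polynomials *)

Section NewtonPoly.
Variable R : fieldType.
Implicit Types (x : nat -> R).

Definition newton_poly x k : {poly R} := \prod_(l < k) ('X - (x l)%:P).

Lemma newton_poly_monic x k : newton_poly x k \is monic.
Proof. exact: monic_prod_XsubC. Qed.

Lemma size_newton_poly x k : size (newton_poly x k) = k.+1.
Proof. by rewrite size_prod_XsubC /index_enum -enumT size_enum_ord. Qed.

Lemma newton_span x d (p : {poly R}) : (size p <= d)%N ->
  exists b : nat -> R, p = \sum_(k < d) b k *: newton_poly x k.
Proof.
elim: d p => [|d IHd] p sp.
  by exists (fun=> 0); rewrite big_ord0; apply/eqP; rewrite -size_poly_leq0.
have [|b bE] := IHd (p - p`_d *: newton_poly x d).
  apply/leq_sizeP => j; rewrite leq_eqVlt => /predU1P[<-|dj].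
    have := monicP (newton_poly_monic x d).
    by rewrite coefB coefZ lead_coefE size_newton_poly /= => ->; rewrite mulr1 subrr.
  rewrite coefB coefZ (nth_default _ (leq_trans sp dj)).
  by rewrite [X in _ * X]nth_default ?size_newton_poly // mulr0 subr0.
exists (fun k => if k == d then p`_d else b k).
rewrite big_ord_recr /= eqxx -[LHS](subrK (p`_d *: newton_poly x d)) bE.
by congr (_ + _); apply: eq_bigr => k _; rewrite ltn_eqF.
Qed.

Lemma newton_free x d (b : nat -> R) :
  \sum_(k < d) b k *: newton_poly x k = 0 -> forall k, (k < d)%N -> b k = 0.
Proof.
elim: d => [|d IHd] //; rewrite big_ord_recr /= => bE.
have bd : b d = 0.
  have /(congr1 (fun p : {poly R} => p`_d)) := bE.
  have := monicP (newton_poly_monic x d).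
  rewrite coefD coefZ lead_coefE size_newton_poly /= => ->.
  rewrite coef_sum big1 ?add0r ?mulr1 ?coef0 // => k _.
  by rewrite coefZ nth_default ?mulr0 // size_newton_poly.
move=> k; rewrite ltnS leq_eqVlt => /predU1P[-> //|]; apply: IHd.
by move: bE; rewrite bd scale0r addr0.
Qed.
End NewtonPoly.

Section Sparse.
Variable R : realFieldType.
Implicit Types (x : nat -> R).

Lemma sparse_newton x m n (a : 'I_n -> nat) (v : 'I_n -> R) :
  exists t, sparse a v =
    \sum_(k < m) (\sum_j v j * newton_coef x (a j) k) *: newton_poly x k
    + t * newton_poly x m.
Proof.
suff H j : exists s, 'X^(a j) = \sum_(k < m) newton_coef x (a j) k *: newton_poly x k
   + s * newton_poly x m.
  have [s sE] := fin_all_exists H.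
  exists (\sum_j v j *: s j); rewrite /sparse mulr_suml.
  under eq_bigr do rewrite sE scalerDr scaler_sumr.
  rewrite big_split exchange_big /=; congr (_ + _); apply: eq_bigr => k _.
    by rewrite scaler_suml; apply: eq_bigr => j' _; rewrite scalerA.
  by rewrite scalerAl.
have [s sE] := newton_expansion (fun k => (x k)%:P) m (a j) 'X.
exists s; rewrite sE; congr (_ + _); apply: eq_bigr => k _.
by rewrite -mul_polyC (newton_coef_morph polyC).
Qed.

(** Divisibility by prod_(k < m) (X - x_k), repeated points included, is a
    linear system in the coefficients, whose matrix is made of Newton
    coefficients. *)
Lemma newton_dvdP x m n (a : 'I_n -> nat) (v : 'I_n -> R) :
  (forall k, (k < m)%N -> \sum_j v j * newton_coef x (a j) k = 0) <->
  newton_poly x m %| sparse a v.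
Proof.
have [t ->] := sparse_newton x m a v; split => [v0|].
  rewrite big1 ?add0r ?dvdp_mull // => k _.
  by rewrite v0 ?scale0r.
rewrite dvdp_addl ?dvdp_mulIr // => dv.
apply: (newton_free (x := x)); apply/eqP; apply: contraTT dv => S0.
rewrite gtNdvdp // size_newton_poly ltnS.
apply: (leq_trans (size_sum _ _ _)); apply/bigmax_leqP => k _.
by rewrite (leq_trans (size_scale_leq _ _)) // size_newton_poly.
Qed.

(** Non-vanishing of Schur functions at positive arguments: a kernel vector
    would be a combination of m monomials with m positive roots. *)
Lemma det_newton_mx_neq0 x m (a : 'I_m -> nat) : injective a ->
  (forall k, (k < m)%N -> 0 < x k) -> \det (newton_mx x m a) != 0.
Proof.
move=> ainj x0; rewrite -det_tr; apply/det0P => -[v v0 vE].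
case/negP: v0; apply/eqP/rowP => j; rewrite mxE.
apply: (@sparse_eq0 _ _ a (v 0) [seq x k | k <- iota 0 m]) => //.
- by apply/allP => y /mapP[k]; rewrite mem_iota => /andP[_ km] ->; exact: x0.
- by rewrite size_map size_iota.
have -> : \prod_(y <- [seq x k | k <- iota 0 m]) ('X - y%:P) = newton_poly x m.
  by rewrite big_map -{1}[m]subn0 -/(index_iota 0 m) big_mkord.
apply/newton_dvdP => k km.
have /rowP/(_ (Ordinal km)) := vE; rewrite !mxE => {2}<-.
by apply: eq_bigr => i _; rewrite !mxE.
Qed.
End Sparse.

Section Minors.
Variable A : comNzRingType.

Definition signed_minor n (M : 'M[A]_(n, n.+1)) (i : 'I_n.+1) : A :=
  (-1) ^+ i * \det (col' i M).

(** Laplace expansion of M bordered by a copy of its own row k. *)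
Lemma signed_minor_kernel n (M : 'M[A]_(n, n.+1)) (k : 'I_n) :
  \sum_i signed_minor M i * M k i = 0.
Proof.
pose B := \matrix_(i < n.+1, j < n.+1) M (odflt k (unlift ord0 i)) j.
have : \det B = 0.
  apply: (@determinant_alternate _ _ _ ord0 (lift ord0 k)) => // j.
  by rewrite !mxE unlift_none liftK.
rewrite (expand_det_row _ ord0); apply: etrans; apply: eq_bigr => i _.
rewrite mxE unlift_none /cofactor add0n mulrC; congr (_ * (_ * \det _)).
by apply/matrixP => a b; rewrite !mxE liftK.
Qed.
End Minors.

(** * Vanishing moments *)

Section Moments.
Variable R : realFieldType.

Definition moments_vanish N m (v a : 'I_N -> R) := forall h : {poly R},
  (size h <= m)%N -> \sum_j v j * h.[a j] = 0.

Lemma horner_newton_nat (a k : nat) :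
  (newton_poly (fun l => l%:R) k).[a%:R] = (a ^_ k)%:R :> R.
Proof.
rewrite horner_prod; elim: k => [|k IHk]; first by rewrite big_ord0 ffactn0.
rewrite big_ord_recr /= IHk ffactnSr natrM hornerXsubC.
have [ka|ak] := leqP k a; first by rewrite natrB.
by rewrite ffact_small // !mul0r.
Qed.

Lemma newton_coef_ffact (t : R) a k :
  t ^+ a * (newton_poly (fun l => l%:R) k).[a%:R] =
  newton_coef (fun=> t) a k * (t ^+ k * k`!%:R).
Proof.
rewrite horner_newton_nat newton_coef_const.
have [ka|ak] := leqP k a; last by rewrite ffact_small // bin_small // mulr0n mulr0 mul0r.
have -> : t ^+ a = t ^+ (a - k) * t ^+ k by rewrite -exprD subnK.
rewrite -bin_ffact natrM -mulr_natr; ring.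
Qed.

(** The derivatives of sum_j v_j X^(a_j) at t are, up to powers of t, the sums of
    the v_j t^(a_j) against the falling factorials of a_j, and these form a basis
    of the polynomials in a_j. *)
Lemma XsubC_exp_dvdP N m (a : 'I_N -> nat) v (t : R) : t != 0 ->
  ('X - t%:P) ^+ m %| sparse a v <->
  moments_vanish m (fun j => v j * t ^+ a j) (fun j => (a j)%:R).
Proof.
move=> t0.
have -> : ('X - t%:P) ^+ m = newton_poly (fun=> t) m.
  by rewrite /newton_poly prodr_const card_ord.
have momE k : \sum_j v j * t ^+ a j * (newton_poly (fun l => l%:R) k).[(a j)%:R] =
    (\sum_j v j * newton_coef (fun=> t) (a j) k) * (t ^+ k * k`!%:R).
  by rewrite mulr_suml; apply: eq_bigr => j _; rewrite -!mulrA newton_coef_ffact.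
split=> [/newton_dvdP v0 h hm|v0].
  have [b ->] := newton_span (fun l => l%:R) hm.
  under eq_bigr do rewrite horner_sum mulr_sumr.
  rewrite exchange_big big1 //= => k _.
  under eq_bigr do rewrite hornerZ mulrCA.
  by rewrite -mulr_sumr momE v0 // mul0r mulr0.
apply/newton_dvdP => k km.
have := v0 (newton_poly (fun l => l%:R) k); rewrite size_newton_poly => /(_ km).
rewrite momE => /eqP; rewrite !mulf_eq0 expf_eq0 (negPf t0) andbF /=.
by rewrite pnatr_eq0 -leqn0 leqNgt fact_gt0 orbF => /eqP.
Qed.

Lemma moments_vanish_mul N m n (v a : 'I_N -> R) (g : {poly R}) :
  moments_vanish n v a -> (size g + m <= n.+1)%N ->
  moments_vanish m (fun j => v j * g.[a j]) a.
Proof.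
move=> v0 gm h hm; rewrite -[RHS](v0 (g * h)); last first.
  rewrite (leq_trans (size_polyMleq _ _)) // -ltnS.
  case: (size g + size h)%N (leq_add2l (size g) (size h) m) => [|s] //=.
  by rewrite hm => sm; exact: leq_trans gm.
by apply: eq_bigr => j _; rewrite hornerM mulrA.
Qed.

Definition lagrange_num N (a : 'I_N -> R) (i : 'I_N) : {poly R} :=
  \prod_(j < N | j != i) ('X - (a j)%:P).

Lemma size_lagrange_num N (a : 'I_N -> R) i : size (lagrange_num a i) = N.
Proof.
rewrite size_prod => [|j _]; last by rewrite polyXsubC_eq0.
under eq_bigr do rewrite size_XsubC.
rewrite sum_nat_const muln2 -addnn -addSn addnK.
by rewrite cardC1 card_ord prednK // (leq_ltn_trans _ (ltn_ord i)).
Qed.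

Lemma horner_lagrange_num N (a : 'I_N -> R) i j : injective a ->
  ((lagrange_num a i).[a j] != 0) = (j == i).
Proof.
move=> ainj; rewrite horner_prod; apply/idP/eqP => [|->].
  apply: contra_neq_eq => ji.
  by rewrite (bigD1 j) //= hornerXsubC subrr mul0r.
apply/prodf_neq0 => l li.
by rewrite hornerXsubC subr_eq0 (inj_eq ainj) eq_sym.
Qed.

Lemma interpolation N (a y : 'I_N -> R) : injective a ->
  exists2 g : {poly R}, (size g <= N)%N & forall i, g.[a i] = y i.
Proof.
move=> ainj.
exists (\sum_i (y i / (lagrange_num a i).[a i]) *: lagrange_num a i).
  rewrite (leq_trans (size_sum _ _ _)) //; apply/bigmax_leqP => i _.
  by rewrite (leq_trans (size_scale_leq _ _)) // size_lagrange_num.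
move=> i; rewrite horner_sum (bigD1 i) //= hornerZ divfK ?horner_lagrange_num //.
rewrite big1 ?addr0 // => j ji; rewrite hornerZ.
have := horner_lagrange_num j i ainj; rewrite [i == j]eq_sym (negPf ji) => /negbFE/eqP->.
by rewrite mulr0.
Qed.

Lemma moments_vanish_full N (v a : 'I_N -> R) : injective a ->
  moments_vanish N v a -> forall i, v i = 0.
Proof.
move=> ainj v0 i; have := v0 (lagrange_num a i); rewrite size_lagrange_num.
rewrite (bigD1 i) //= big1 => [|j ji].
  rewrite addr0 => /(_ (leqnn _)) /eqP; rewrite mulf_eq0.
  have li : (lagrange_num a i).[a i] != 0 by rewrite horner_lagrange_num.
  by rewrite (negPf li) orbF => /eqP.
have := horner_lagrange_num i j ainj; rewrite (negPf ji) => /negbFE/eqP->.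
by rewrite mulr0.
Qed.

(** The functional h |-> sum_j w_j h(a_j) on the polynomials of degree <= n kills
    the degrees < n but not everything, hence it is a non-zero multiple of the
    coefficient of degree n.  If g had degree > n - m, then g X^d of degree
    exactly n, with d < m, would contradict the second moment hypothesis. *)
Lemma moments_vanish_size n m (w a : 'I_n.+1 -> R) (g : {poly R}) :
  injective a -> (exists i, w i != 0) -> (m <= n)%N -> (size g <= n.+1)%N ->
  moments_vanish n w a -> moments_vanish m (fun i => w i * g.[a i]) a ->
  (size g + m <= n.+1)%N.
Proof.
move=> ainj [i wi] mn gn w0 g0; rewrite leqNgt; apply: contra wi => gm.
apply/eqP; apply: (moments_vanish_full ainj) => h hn.
have gpos : (0 < size g)%N.
  by rewrite lt0n; apply: contraTneq gm => ->; rewrite add0n -leqNgt leqW.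
have g_neq0 : g != 0 by rewrite -size_poly_gt0.
set d := (n.+1 - size g)%N.
have dm : (d < m)%N by rewrite ltn_subLR // -ltnS.
(* A polynomial on which the functional vanishes and whose degree is n. *)
pose f := g * 'X^d.
have sf : size f = n.+1 by rewrite size_mulXn // subnK.
have f0 : \sum_j w j * f.[a j] = 0.
  rewrite -[RHS](g0 'X^d) ?size_polyXn //.
  by apply: eq_bigr => j _; rewrite hornerM mulrA.
have lf : f`_n != 0 by have := lead_coef_eq0 f; rewrite lead_coefE sf /= => ->;
  rewrite -size_poly_gt0 sf.
rewrite -[h](subrK ((h`_n / f`_n) *: f)).
under eq_bigr do rewrite hornerD mulrDr [X in _ + _ * X]hornerZ [X in _ + X]mulrCA.
rewrite big_split /= -mulr_sumr f0 mulr0 addr0; apply: w0.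
apply/leq_sizeP => j; rewrite coefB coefZ leq_eqVlt => /predU1P[<-|nj].
  by rewrite divfK // subrr.
rewrite (nth_default _ (leq_trans hn nj)) [X in _ * X]nth_default ?sf //.
by rewrite mulr0 subr0.
Qed.
End Moments.

(** Powers of distinct linear factors are coprime. *)
Lemma dvdp_prod_count (F : fieldType) (s : seq F) (p : {poly F}) :
  (forall t, t \in s -> ('X - t%:P) ^+ count_mem t s %| p) ->
  \prod_(t <- s) ('X - t%:P) %| p.
Proof.
elim: s p => [|a s IHs] p sp; first by rewrite big_nil dvd1p.
have /dvdpP[p' pE] : 'X - a%:P %| p.
  apply: dvdp_trans (sp a (mem_head _ _)).
  by rewrite /= eqxx add1n exprS dvdp_mulIl.
rewrite big_cons pE mulrC dvdp_mul // IHs // => t ts.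
have := sp t; rewrite inE ts orbT => /(_ isT) /=; rewrite pE.
have [->|ta] := eqVneq a t.
  by rewrite add1n exprSr dvdp_mul2r // polyXsubC_eq0.
rewrite add0n Gauss_dvdpl // coprimep_expl // coprimep_XsubC.
by rewrite root_XsubC.
Qed.

(** * Interpolation weights at the points of a tuple *)

Section Blossom.
Variables (R : realFieldType) (n : nat) (u : 'I_n -> R) (D : 'I_n.+1 -> nat).
Hypothesis u_gt0 : forall k, 0 < u k.
Hypothesis D_inj : injective D.

Let mu t := #|[pred k | u k == t]|.
Let Dr j : R := (D j)%:R.

Lemma mult_le t : (mu t <= n)%N.
Proof. by rewrite -[leqRHS]card_ord max_card. Qed.

Lemma Dr_inj : injective Dr.
Proof. by move=> i j /eqP; rewrite eqr_nat => /eqP/D_inj. Qed.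

Variables w q : 'I_n.+1 -> R.
Hypothesis w_neq0 : forall i, w i != 0.
Hypothesis w_dvd : ('X - 1%:P) ^+ n %| sparse D w.
Hypothesis q_dvd : \prod_(k < n) ('X - (u k)%:P) %| sparse D q.

Lemma w_moments : moments_vanish n w Dr.
Proof.
have /(XsubC_exp_dvdP _ _ _ (oner_neq0 _)) := w_dvd => w0 h hn.
by rewrite -[RHS](w0 h hn); apply: eq_bigr => j _; rewrite expr1n mulr1.
Qed.

Lemma multiplicity_dvd k :
  ('X - (u k)%:P) ^+ mu (u k) %| \prod_(l < n) ('X - (u l)%:P).
Proof.
rewrite (bigID (fun l => u l == u k)) /= dvdp_mulr //.
rewrite (eq_bigr (fun=> 'X - (u k)%:P)) => [|l /eqP-> //].
by rewrite prodr_const dvdpp.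
Qed.

Lemma dvdp_multiplicities (p : {poly R}) :
  (forall k, ('X - (u k)%:P) ^+ mu (u k) %| p) ->
  \prod_(l < n) ('X - (u l)%:P) %| p.
Proof.
move=> up; rewrite -big_enum -(big_map u predT (fun y => 'X - y%:P)).
apply: dvdp_prod_count => t /mapP[k _ ->].
suff -> : count_mem (u k) (map u (enum 'I_n)) = mu (u k) by [].
by rewrite count_map -size_filter /mu cardE {2}/enum_mem -enumT.
Qed.

(** In homogeneous coordinates: the point (q_i / w_i)_i lies in all the
    osculating flats whose intersection defines the blossom. *)
Lemma osculating_interpolant k : exists2 g : {poly R}, (size g <= (n - mu (u k)).+1)%N &
  forall i, q i * u k ^+ D i = w i * g.[Dr i].
Proof.
set t := u k; have t0 : t != 0 by rewrite lt0r_neq0 ?u_gt0.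
have [g gn gE] := interpolation (fun i => q i * t ^+ D i / w i) Dr_inj.
have wgE i : q i * t ^+ D i = w i * g.[Dr i] by rewrite gE [RHS]mulrC divfK.
exists g => //; rewrite -(leq_add2r (mu t)) addSn subnK ?mult_le //.
apply: (moments_vanish_size Dr_inj _ (mult_le t) gn w_moments).
  by exists ord0; exact: w_neq0.
have /(XsubC_exp_dvdP _ _ _ t0) q0 := dvdp_trans (multiplicity_dvd k) q_dvd.
by move=> h hm; rewrite -[RHS](q0 h hm); apply: eq_bigr => j _; rewrite wgE.
Qed.

(** In homogeneous coordinates: the flats have no other common point.  The
    sparse polynomial with coefficients r is divisible by the same product as
    that of q, and the combination that kills the coefficient of index 0 has n
    terms and n positive roots. *)
Lemma osculating_interpolant_unique (r : 'I_n.+1 -> R) :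
  (forall k, exists2 g : {poly R}, (size g <= (n - mu (u k)).+1)%N &
     forall i, r i * u k ^+ D i = w i * g.[Dr i]) ->
  forall i, q ord0 * r i = r ord0 * q i.
Proof.
move=> rg.
have r_dvd : \prod_(k < n) ('X - (u k)%:P) %| sparse D r.
  apply: dvdp_multiplicities => k; have [g gm gE] := rg k.
  apply/XsubC_exp_dvdP; first by rewrite lt0r_neq0.
  have gn : (size g + mu (u k) <= n.+1)%N.
    by rewrite -(subnK (mult_le (u k))) -addSn leq_add2r.
  move=> h hm; rewrite -[RHS](moments_vanish_mul w_moments gn hm).
  by apply: eq_bigr => j _; rewrite gE.
pose z i := q ord0 * r i - r ord0 * q i.
suff z0 i : z i = 0 by move=> i; apply/eqP; rewrite -subr_eq0 -/(z i) z0.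
have [j ->|->] := unliftP ord0 i; last by rewrite /z mulrC subrr.
have := @sparse_eq0 _ _ (D \o lift ord0) (z \o lift ord0) (map u (enum 'I_n)).
apply.
- by apply: inj_comp D_inj _; exact: lift_inj.
- by apply/allP => y /mapP[k _ ->].
- by rewrite size_map size_enum_ord.
rewrite big_map big_enum.
have -> : sparse (D \o lift ord0) (z \o lift ord0) =
    q ord0 *: sparse D r - r ord0 *: sparse D q.
  rewrite /sparse !scaler_sumr -sumrB big_ord_recl !scalerA.
  rewrite [r _ * _]mulrC subrr add0r; apply: eq_bigr => l _.
  by rewrite !scalerA -scalerBl.
by rewrite dvdp_sub // -mul_polyC dvdp_mull.
Qed.
End Blossom.

(** * Schur polynomials as determinants of Newton coefficients *)

Definition extend (V : nmodType) m (u : 'I_m -> V) (k : nat) : V :=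
  oapp u 0 (insub k).

Lemma extend_ord (V : nmodType) m (u : 'I_m -> V) (i : 'I_m) :
  extend u i = u i.
Proof. by rewrite /extend valK. Qed.

Lemma extend_morph (V W : nmodType) (f : {additive V -> W}) m (u : 'I_m -> V) :
  f \o extend u =1 extend (f \o u).
Proof. by move=> k; rewrite /= /extend; case: insub => //=; rewrite raddf0. Qed.

Definition shifted_part m (mu : seq nat) (j : 'I_m) : nat :=
  (nth 0%N mu j + (m - j.+1))%N.

Lemma signed_quotient (A : idomainType) (l s d x : A) :
  l != 0 -> s * s = 1 -> x * (l * s) = l * d -> x = s * d.
Proof.
move=> l0 ss xE; apply: (mulfI l0).
by rewrite mulrCA -xE mulrCA [s * _]mulrCA ss mulr1 mulrC.
Qed.

Section Schur.
Variables (R : idomainType) (m : nat).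

Let X := extend (fun i : 'I_m => mpolyX R (mnm1 i)).
Let L := \matrix_(i < m, k < m) newton_basis X k (X i).

Lemma alternantE mu :
  alternant R m mu = \det L * \det (newton_mx X m (shifted_part mu)).
Proof.
rewrite /L -det_mulmx -power_mx_factor; congr (\det _).
by apply/matrixP => i j; rewrite !mxE /X extend_ord.
Qed.

(** The matrix is triangular with diagonal entries prod_(l < i) (X_i - X_l). *)
Lemma det_newton_basis_neq0 : \det L != 0.
Proof.
rewrite det_trig; last first.
  by apply/is_trig_mxP => i k ik; rewrite mxE newton_basis_eq0.
apply/prodf_neq0 => i _; rewrite mxE; apply/prodf_neq0 => l _.
rewrite subr_eq0 /X (extend_ord _ i).
have lm : (l < m)%N by apply: ltn_trans (ltn_ord i).
rewrite (extend_ord _ (Ordinal lm)).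
apply/eqP => /(congr1 (mcoeff (mnm1 i))).
rewrite !mcoeffXU eqxx -val_eqE /= ltn_eqF ?ltn_ord // => /eqP.
by rewrite oner_eq0.
Qed.

(** Alternants share the factor [\det L]; the empty partition contributes only
    a sign beyond it.  This is a variant of the Jacobi-Trudi identity, in which the
    complete homogeneous polynomials involve initial segments of the variables. *)
Lemma schurE mu : schur R m mu =
  rev_sign _ m * \det (newton_mx X m (shifted_part mu)).
Proof.
have nilE : alternant R m [::] = \det L * rev_sign _ m.
  rewrite alternantE -(det_newton_mx_rev X); congr (_ * \det _).
  by apply/matrixP => i j; rewrite !mxE /shifted_part nth_nil.
have sgn2 : rev_sign (mpoly m R) m * rev_sign _ m = 1.
  by rewrite -expr2 sqrr_sign.
apply: xget_unique => [/=|s /= sE].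
  by rewrite nilE alternantE mulrACA [_ * \det L]mulrC mulrACA sgn2 mulr1.
by apply: (signed_quotient det_newton_basis_neq0 sgn2); rewrite -nilE sE alternantE.
Qed.

(** The determinant commutes with evaluation, whether or not the arguments are
    distinct. *)
Lemma schur_atE mu (u : 'I_m -> R) : schur_at mu u =
  rev_sign _ m * \det (newton_mx (extend u) m (shifted_part mu)).
Proof.
rewrite /schur_at schurE rmorphM rmorph_sign -det_map_mx.
congr (_ * \det _); apply/matrixP => k j; rewrite !mxE newton_coef_morph.
apply: (eq_newton_coef _ (ltn_ord k)) => l _.
rewrite extend_morph /extend /=; case: insub => //= i.
by rewrite mevalXU.
Qed.
End Schur.

(** * Osculating flats of a monomial curve *)

Section Osculating.
Variables (R : realType) (n : nat) (e : 'I_n -> nat).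

Lemma derive1n_monomials l :
  derive1n l (fun t : R => \col_(i < n) t ^+ e i) =
  (fun t => \col_i (('X^(e i))^`(l)).[t]).
Proof.
elim: l => [|l IHl]; apply/funext => t.
  by apply/matrixP => i j; rewrite !mxE /= hornerXn.
have dlt : derivable (fun t : R => \col_(i < n) (('X^(e i))^`(l)).[t]) t 1.
  apply/derivable_mxP => i j.
  under eq_fun do rewrite mxE.
  exact: derivable_horner.
rewrite derive1nS IHl derive1E derive_mx //; apply/matrixP => i j; rewrite !mxE.
under [X in 'D_1 X t]eq_fun do rewrite mxE.
by rewrite -derive1E -derivE.
Qed.

(** The k-th derivative of t^(e_i) is t^(e_i - k) times the k-th falling
    factorial of e_i, and the falling factorials of degree <= d span the
    polynomials of degree <= d.  The coefficient 1 of phi(t) becomes g(0) = 1. *)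
Lemma osculatingP (d : nat) (t : R) (x : 'cV[R]_n) : t != 0 ->
  osculating (fun t : R => \col_(i < n) t ^+ e i) d t x <->
  exists g : {poly R}, [/\ (size g <= d.+1)%N, g.[0] = 1 &
    forall i, x i 0 = t ^+ e i * g.[(e i)%:R]].
Proof.
move=> t0.
pose N k : {poly R} := newton_poly (fun l => l%:R) k.
have N0 : N 0%N = 1 by rewrite /N /newton_poly big_ord0.
have NS0 k : (N k.+1).[0] = 0.
  by rewrite -[0]/(0%:R) horner_newton_nat ffact0n.
have dE k i : derive1n k (fun t : R => \col_(i < n) t ^+ e i) t i 0 * t ^+ k =
    t ^+ e i * (N k).[(e i)%:R].
  rewrite derive1n_monomials mxE derivnXn hornerMn hornerXn horner_newton_nat.
  have [ke|ek] := leqP k (e i); last by rewrite ffact_small // mulr0n mul0r mulr0.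
  by rewrite mulrnAl -exprD subnK // mulr_natr.
split=> [[al ->]|[g [gd g0 xE]]].
  exists (1 + \sum_(j < d) (al j / t ^+ j.+1) *: N j.+1); split.
  - rewrite (leq_trans (size_polyD _ _)) // geq_max size_poly1 ltn0Sn /=.
    rewrite (leq_trans (size_sum _ _ _)) //; apply/bigmax_leqP => k _.
    by rewrite (leq_trans (size_scale_leq _ _)) // size_newton_poly ltnS.
  - rewrite hornerD hornerC horner_sum big1 ?addr0 // => k _.
    by rewrite hornerZ NS0 mulr0.
  move=> i; rewrite !mxE hornerD hornerC mulrDr mulr1; congr (_ + _).
  rewrite summxE horner_sum mulr_sumr; apply: eq_bigr => k _.
  by rewrite mxE hornerZ mulrCA -dE mulrCA mulfVK ?expf_neq0 // mulrC.
have [b bE] := newton_span (fun l => l%:R) gd.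
rewrite big_ord_recl -!/(N _) N0 in bE.
have b0 : b 0%N = 1.
  rewrite -g0 bE hornerD hornerZ hornerC mulr1 horner_sum big1 ?addr0 // => k _.
  by rewrite hornerZ NS0 mulr0.
exists (fun j => b j.+1 * t ^+ j.+1); apply/matrixP => i j.
rewrite (ord1 j) xE bE b0 scale1r hornerD hornerC mulrDr mulr1 !mxE; congr (_ + _).
rewrite summxE horner_sum mulr_sumr; apply: eq_bigr => k _.
by rewrite mxE hornerZ mulrCA -dE mulrAC mulrA.
Qed.
End Osculating.

(** * The Muntz tableau *)

Lemma nth_partition (lam : seq nat) i j : sorted geq lam -> (i <= j)%N ->
  (nth 0%N lam j <= nth 0%N lam i)%N.
Proof.
move=> lams ij; have [sj|js] := leqP (size lam) j; first by rewrite nth_default.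
apply: (sorted_leq_nth _ _ 0%N lams) => //; last by rewrite inE (leq_ltn_trans ij).
- by move=> a b c ab bc; apply: leq_trans bc ab.
- exact: leqnn.
Qed.

(** The exponents of lam seen as a partition with n+1 parts. *)
Definition muntz_exponent n (lam : seq nat) (i : 'I_n.+1) : nat :=
  (nth 0%N lam i + (n - i))%N.

Lemma muntz_exponent_inj n (lam : seq nat) : sorted geq lam ->
  injective (@muntz_exponent n lam).
Proof.
move=> lams i j; rewrite /muntz_exponent => ij; apply: val_inj => /=.
have := ltn_ord i; have := ltn_ord j.
case: (ltngtP i j) => // [lt|lt]; have := nth_partition lams (ltnW lt); lia.
Qed.

(** The i-th row of the Muntz tableau omits the i-th exponent. *)
Lemma muntz_exponent_row n (lam : seq nat) (i : 'I_n.+1) : size lam = n ->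
  shifted_part (muntz_row lam i) =1 @muntz_exponent n lam \o lift i.
Proof.
move=> sz j; rewrite /shifted_part /muntz_row /muntz_exponent /=.
have il := ltn_ord i; have jl := ltn_ord j.
have st : size (take i lam) = i by rewrite size_takel // sz.
rewrite nth_cat size_map st /bump.
have [ji|ij] := ltnP j i.
  rewrite (nth_map 0%N) ?st // nth_take // add0n addSnnS -subSn // subSS.
rewrite nth_drop add1n addSn subnKC //.
Qed.

(** The exponents of the curve are those of lam read backwards. *)
Lemma muntz_exponent_curve n (lam : seq nat) (i : 'I_n) : sorted geq lam ->
  (nth 0 lam 0 - nth 0 lam i.+1 + i.+1 + muntz_exponent lam (lift ord0 i) =
   muntz_exponent lam (@ord0 n))%N.
Proof.
move=> lams; rewrite /muntz_exponent /= /bump add1n.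
have := nth_partition lams (leq0n i.+1); have := ltn_ord i; lia.
Qed.

Lemma size_comp_reflect (R : realFieldType) (T : R) (g : {poly R}) :
  size (g \Po (T%:P - 'X)) = size g.
Proof.
apply: size_comp_poly2.
by rewrite addrC size_polyDl size_polyN size_polyX // ltnS size_polyC_leq1.
Qed.

Section MuntzBlossom.
Variables (R : realType) (n : nat) (lam : seq nat).
Hypothesis lam_sorted : sorted geq lam.
Variable u : 'I_n -> R.
Hypothesis u_gt0 : forall k, 0 < u k.

Local Notation D := (@muntz_exponent n lam).
(** Up to a sign common to all i, this is (-1)^i times the value at v of the
    Schur polynomial of the i-th row. *)
Definition muntz_minor (v : 'I_n -> R) (i : 'I_n.+1) : R :=
  signed_minor (newton_mx (extend v) n D) i.

Lemma muntz_minorE v i : muntz_minor v i =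
  (-1) ^+ i * \det (newton_mx (extend v) n (D \o lift i)).
Proof.
by congr (_ * \det _); apply/matrixP => k j; rewrite !mxE.
Qed.

Lemma muntz_minor_neq0 v i : (forall k, 0 < v k) -> muntz_minor v i != 0.
Proof.
move=> v0; rewrite muntz_minorE mulf_neq0 ?signr_eq0 // det_newton_mx_neq0 //.
  apply: inj_comp (muntz_exponent_inj lam_sorted) _; exact: lift_inj.
by move=> k kn; rewrite (extend_ord v (Ordinal kn)).
Qed.

Lemma muntz_minor_dvd v :
  \prod_(k < n) ('X - (v k)%:P) %| sparse D (muntz_minor v).
Proof.
have -> : \prod_(k < n) ('X - (v k)%:P) = newton_poly (extend v) n.
  by apply: eq_bigr => k _; rewrite extend_ord.
apply/newton_dvdP => k kn.
rewrite -[RHS](signed_minor_kernel (newton_mx (extend v) n D) (Ordinal kn)).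
by apply: eq_bigr => j _; rewrite mxE.
Qed.

Local Notation q := (muntz_minor u).
Local Notation w := (muntz_minor (fun=> 1)).

Let w_neq0 i : w i != 0. Proof. by apply: muntz_minor_neq0 => _; exact: ltr01. Qed.
Let q_neq0 i : q i != 0. Proof. exact: muntz_minor_neq0. Qed.
Let w_dvd : ('X - 1%:P) ^+ n %| sparse D w.
Proof.
by have := muntz_minor_dvd (fun=> 1); rewrite prodr_const card_ord.
Qed.

Definition blossom_point : 'cV[R]_n :=
  \col_(i < n) ((w ord0 * q (lift ord0 i)) / (w (lift ord0 i) * q ord0)).

Let e (i : 'I_n) := (nth 0%N lam 0 - nth 0%N lam i.+1 + i.+1)%N.

Let exponent_sum i : (e i + D (lift ord0 i) = D ord0)%N.
Proof. exact: muntz_exponent_curve. Qed.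

Let curve_exponentE i : (D ord0)%:R - (D (lift ord0 i))%:R = (e i)%:R :> R.
Proof. by rewrite -(exponent_sum i) natrD addrK. Qed.

Let D_inj : injective D := muntz_exponent_inj lam_sorted.

(** The reflection g(x) |-> g(D_0 - x) turns interpolation at the exponents D_i
    into the description of the osculating flats in terms of the exponents
    D_0 - D_i of the curve. *)
Lemma osculating_meet_muntz :
  osculating_meet (@muntz_curve R n lam) u = [set blossom_point]%classic.
Proof.
have T_refl (T a : R) (g : {poly R}) : (g \Po (T%:P - 'X)).[a] = g.[T - a].
  by rewrite horner_comp hornerD hornerN hornerC hornerX.
pose T : R := (D ord0)%:R.
apply/seteqP; split=> [x xu|_ -> _ [k _ <-]] /=.
- (* The homogeneous coordinates of x, the 0-th being 1, weighted by w. *)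
  pose r i := w i * oapp (fun j => x j 0) 1 (unlift ord0 i).
  have r_prop : forall i, q ord0 * r i = r ord0 * q i.
    apply: (osculating_interpolant_unique u_gt0 D_inj w_dvd (muntz_minor_dvd u)) => k.
    have t0 : u k != 0 by rewrite lt0r_neq0.
    have /(osculatingP _ _ _ t0)[g [gs g0 xE]] := xu (u k) (ex_intro2 _ _ k I erefl).
    exists (u k ^+ D ord0 *: (g \Po (T%:P - 'X))).
      by rewrite (leq_trans (size_scale_leq _ _)) // size_comp_reflect.
    move=> l; rewrite hornerZ T_refl /r -mulrA; congr (_ * _).
    have [l' ->|->] := unliftP ord0 l; last by rewrite /= subrr g0 mulr1 mul1r.
    by rewrite /= curve_exponentE xE -/(e l') -(exponent_sum l') [in RHS]exprD mulrAC.
  apply/matrixP => i j; rewrite (ord1 j) mxE.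
  have := r_prop (lift ord0 i); rewrite /r liftK unlift_none /= mulr1 => <-.
  field.
  by rewrite q_neq0 w_neq0.
have t0 : u k != 0 by rewrite lt0r_neq0.
apply/(osculatingP _ _ _ t0).
have [g gs gE] := osculating_interpolant u_gt0 D_inj w_neq0 w_dvd (muntz_minor_dvd u) k.
(* Normalises the value at the 0-th exponent, where q / w need not be 1. *)
pose c := w ord0 / (q ord0 * u k ^+ D ord0).
exists (c *: (g \Po (T%:P - 'X))); split.
- by rewrite (leq_trans (size_scale_leq _ _)) // size_comp_reflect.
- rewrite hornerZ T_refl subr0 /c mulrAC -gE divff //.
  by rewrite mulf_neq0 ?expf_neq0.
move=> i; rewrite hornerZ T_refl mxE.
have -> : T - (e i)%:R = (D (lift ord0 i))%:R.
  by rewrite -curve_exponentE opprB addrC subrK.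
have -> : g.[(D (lift ord0 i))%:R] =
    q (lift ord0 i) * u k ^+ D (lift ord0 i) / w (lift ord0 i).
  by rewrite gE mulrAC divff // mul1r.
rewrite -/(e i) /c -(exponent_sum i) [u k ^+ (e i + _)]exprD.
field.
by rewrite q_neq0 w_neq0 !expf_neq0.
Qed.

End MuntzBlossom.

Theorem theorem3 (R : realType) (n : nat) (hn : (1 <= n)%N)
  (lam : n.-tuple nat) (hlam : sorted geq lam)
  (u : 'I_n -> R) (hu : forall k : 'I_n, 0 < u k) (i : 'I_n) :
  blossom (@muntz_curve R n lam) u i 0 =
    (schur_ones R n (muntz_row lam 0) * schur_at (muntz_row lam i.+1) u) /
    (schur_ones R n (muntz_row lam i.+1) * schur_at (muntz_row lam 0) u).
Proof.
have -> : blossom (@muntz_curve R n lam) u = blossom_point lam u.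
  rewrite /blossom (osculating_meet_muntz hlam hu).
  by apply: xget_unique => // p /= /esym/seteqP[+ _]; apply.
have schur_minor v (j : 'I_n.+1) : schur_at (muntz_row lam j) v =
    rev_sign R n * (-1) ^+ j * muntz_minor lam v j.
  rewrite schur_atE muntz_minorE -mulrA; congr (_ * _).
  rewrite mulrA -expr2 sqrr_sign mul1r; congr (\det _).
  apply/matrixP => k l; rewrite !mxE.
  by rewrite muntz_exponent_row ?size_tuple.
rewrite /schur_ones !(schur_minor _ ord0) !(schur_minor _ (lift ord0 i)) mxE.
have w0 j : muntz_minor lam (fun _ : 'I_n => 1 : R) j != 0.
  by apply: muntz_minor_neq0 => // _; exact: ltr01.
have q0 j := muntz_minor_neq0 hlam j hu.
field.
by rewrite q0 w0 /rev_sign !signr_eq0.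
Qed.
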